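(* For a finite generalized possibilistic Kripke structure $M=(S,P,I,AP,L)$ and a GPoCTL state formula $\Phi$, the GPoCTL model-checking problem for $M$ and $\Phi$ (computing the value $\|\Phi\|(s)$ for every state $s\in S$) can be solved in time $\mathcal O(\mathrm{size}(M)\cdot \mathrm{poly}(|S|)\cdot|\Phi|)$, where $\mathrm{poly}(|S|)$ is some polynomial in $|S|$.
   Context: A generalized possibilistic Kripke structure (GPKS) is a tuple $M=(S,P,I,AP,L)$ with $S$ a countable nonempty set of states, $P:S\times S\to[0,1]$, $I:S\to[0,1]$ arbitrary functions, $AP$ a set of atomic propositions, $L:S\times AP\to[0,1]$; $M$ is finite if $S$ and $AP$ are finite; $\mathrm{size}(M)$ is the size of the representation of $M$ (number of states plus number of transitions). A path is an infinite sequence $\pi=s_0s_1\cdots$ with $P(s_i,s_{i+1})>0$ for all $i$; $\pi[k]=s_k$; $Paths(s)$ is the set of paths with $\pi[0]=s$. $\vee,\wedge$ are sup and inf in $[0,1]$ (empty sup $=0$). GPoCTL state formulae: $\Phi::=true\mid a\mid\Phi_1\wedge\Phi_2\mid\neg\Phi\mid Po(\varphi)$ with $a\in AP$; path formulae: $\varphi::=\bigcirc\Phi\mid\Phi_1\sqcup\Phi_2\mid\Phi_1\sqcup^{\le n}\Phi_2\mid\square\Phi$ with $n\in\mathbb N$. The length $|\Phi|$ (number of subformulae) is: $|\Phi|=1$ for $\Phi\in AP\cup\{true\}$, $|\Phi\wedge\Psi|=|\Phi|+|\Psi|+1$, $|\neg\Phi|=|\Phi|+1$, $|Po(\bigcirc\Phi)|=|Po(\square\Phi)|=|\Phi|+1$,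 $|Po(\Phi\sqcup\Psi)|=|Po(\Phi\sqcup^{\le n}\Psi)|=|\Phi|+|\Psi|+1$. Semantics: $\|true\|(s)=1$, $\|a\|(s)=L(s,a)$, $\|\Phi\wedge\Psi\|(s)=\|\Phi\|(s)\wedge\|\Psi\|(s)$, $\|\neg\Phi\|(s)=1-\|\Phi\|(s)$, $\|Po(\varphi)\|(s)=\bigvee_{\pi\in Paths(s)}\left(\bigwedge_{i\ge0}P(\pi[i],\pi[i+1])\right)\wedge\|\varphi\|(\pi)$. For paths: $\|\bigcirc\Phi\|(\pi)=P(\pi[0],\pi[1])\wedge\|\Phi\|(\pi[1])$; $\|\Phi\sqcup\Psi\|(\pi)=\|\Psi\|(\pi[0])\vee\bigvee_{j>0}\left(\bigwedge_{k<j}\|\Phi\|(\pi[k])\wedge\bigwedge_{k=1}^{j}P(\pi[k-1],\pi[k])\wedge\|\Psi\|(\pi[j])\right)$; $\|\Phi\sqcup^{\le n}\Psi\|$ is the same with $0<j\le n$; $\|\square\Phi\|(\pi)=\bigwedge_{i\ge0}\left(\bigwedge_{j<i}P(\pi[j],\pi[j+1])\wedge\|\Phi\|(\pi[i])\right)$. *)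

(* Defs.v *)
From mathcomp Require Import all_boot all_order all_algebra.
From mathcomp Require Import classical_sets reals.

Set Implicit Arguments.
Unset Strict Implicit.
Unset Printing Implicit Defensive.

Import Order.TTheory GRing.Theory Num.Theory.
Local Open Scope classical_set_scope.
Local Open Scope ring_scope.

(** * Generalized possibilistic Kripke structures *)

Record gpks (R : realType) (S : countType) (AP : Type) := GPKS {
  gpks_P : S -> S -> R;
  gpks_I : S -> R;
  gpks_L : S -> AP -> R;
  gpks_inhabited : inhabited S;
  gpks_P01 : forall s t, 0 <= gpks_P s t <= 1;
  gpks_I01 : forall s, 0 <= gpks_I s <= 1;
  gpks_L01 : forall s a, 0 <= gpks_L s a <= 1
}.

Definition paths (R : realType) (S : countType) (AP : Type)
    (M : gpks R S AP) (s : S) : set (nat -> S) :=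
  [set pi | pi 0%N = s /\ forall i, 0 < gpks_P M (pi i) (pi i.+1)].

(* Number of states plus number of transitions. *)
Definition gpks_size (R : realType) (S : finType) (AP : Type)
    (M : gpks R S AP) : nat :=
  (#|S| + #|[pred st : S * S | 0 < gpks_P M st.1 st.2]%R|)%N.

(** * GPoCTL *)

Inductive sform (AP : Type) : Type :=
| STrue
| SAtom of AP
| SAnd of sform AP & sform AP
| SNot of sform AP
| SPo of pform AP
with pform (AP : Type) : Type :=
| PNext of sform AP
| PUntil of sform AP & sform AP
| PBUntil of nat & sform AP & sform AP
| PAlways of sform AP.

Arguments STrue {AP}.

(* The operator Po and the temporal operator below it count together for
   one, and the bound of a bounded until does not count. *)
Fixpoint slen (AP : Type) (f : sform AP) : nat :=
  match f with
  | STrue => 1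
  | SAtom _ => 1
  | SAnd g h => (slen g + slen h + 1)%N
  | SNot g => (slen g + 1)%N
  | SPo phi => plen phi
  end
with plen (AP : Type) (phi : pform AP) : nat :=
  match phi with
  | PNext g => (slen g + 1)%N
  | PUntil g h => (slen g + slen h + 1)%N
  | PBUntil _ g h => (slen g + slen h + 1)%N
  | PAlways g => (slen g + 1)%N
  end.

(* All sets below are subsets of [0, 1]; [sup set0] is 0, every [inf] is taken
   over a nonempty set, and finite meets are iterated minima starting at 1. *)
Section Semantics.
Variables (R : realType) (S : countType) (AP : Type) (M : gpks R S AP).
Local Notation P := (gpks_P M).
Local Notation min := Order.min.
Local Notation max := Order.max.

Definition until_at (f g : S -> R) (pi : nat -> S) (j : nat) : R :=
  min (min (\big[min/1]_(0 <= k < j) f (pi k))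
           (\big[min/1]_(1 <= k < j.+1) P (pi k.-1) (pi k)))
      (g (pi j)).

Fixpoint sem (f : sform AP) (s : S) : R :=
  match f with
  | STrue => 1
  | SAtom a => gpks_L M s a
  | SAnd g h => min (sem g s) (sem h s)
  | SNot g => 1 - sem g s
  | SPo phi =>
      sup [set min (inf [set P (pi i) (pi i.+1) | i in [set: nat]])
               (psem phi pi) | pi in paths M s]
  end
with psem (phi : pform AP) (pi : nat -> S) : R :=
  match phi with
  | PNext g => min (P (pi 0%N) (pi 1%N)) (sem g (pi 1%N))
  | PUntil g h =>
      max (sem h (pi 0%N))
          (sup [set until_at (sem g) (sem h) pi j | j in [set j | (0 < j)%N]])
  | PBUntil n g h =>
      max (sem h (pi 0%N))
          (sup [set until_at (sem g) (sem h) pi j |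
                 j in [set j | (0 < j <= n)%N]])
  | PAlways g =>
      inf [set min (\big[min/1]_(0 <= j < i) P (pi j) (pi j.+1)) (sem g (pi i))
          | i in [set: nat]]
  end.

End Semantics.

(** * Random access machine

   A random access machine with natural-number arrays and value arrays,
   programmed in a structured language.  Arrays are named by literals, so a
   program uses finitely many of them; a scalar variable is an array accessed
   at index 0.  A program is a finite text independent of its input.  The
   arithmetic is limited to addition and truncated subtraction of naturals and
   to min, max and complement on values, so that unit cost per operation does
   not make the machine unreasonably powerful. *)

Inductive nexp : Type :=
| NLit of nat
| NGet of nat & nexp            (* NGet a e : cell e of number array a *)
| NAdd of nexp & nexp
| NSub of nexp & nexp.

Inductive vexp : Type :=
| VZero
| VOne
| VGet of nat & nexp            (* VGet a e : cell e of value array a *)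
| VMin of vexp & vexp
| VMax of vexp & vexp
| VCompl of vexp.

Inductive bexp : Type :=
| BNLe of nexp & nexp
| BVLe of vexp & vexp
| BNot of bexp.

Inductive cmd : Type :=
| Skip
| NSet of nat & nexp & nexp     (* NSet a e x : cell e of number array a := x *)
| VSet of nat & nexp & vexp
| Seq of cmd & cmd
| If of bexp & cmd & cmd
| While of bexp & cmd.

Record store (R : Type) := Store {
  nmem : nat -> nat -> nat;
  vmem : nat -> nat -> R
}.

Definition upd (T : Type) (m : nat -> nat -> T) (a i : nat) (x : T) :
    nat -> nat -> T :=
  fun b j => if (b == a) && (j == i) then x else m b j.

Section Execution.
Local Open Scope nat_scope.
Variable R : realType.
Implicit Types st : store R.

Fixpoint neval st (e : nexp) : nat :=
  match e with
  | NLit n => n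
  | NGet a e1 => nmem st a (neval st e1)
  | NAdd e1 e2 => neval st e1 + neval st e2
  | NSub e1 e2 => neval st e1 - neval st e2
  end.

Fixpoint veval st (e : vexp) : R :=
  match e with
  | VZero => 0%R
  | VOne => 1%R
  | VGet a e1 => vmem st a (neval st e1)
  | VMin e1 e2 => Order.min (veval st e1) (veval st e2)
  | VMax e1 e2 => Order.max (veval st e1) (veval st e2)
  | VCompl e1 => (1 - veval st e1)%R
  end.

Fixpoint beval st (b : bexp) : bool :=
  match b with
  | BNLe e1 e2 => neval st e1 <= neval st e2
  | BVLe e1 e2 => (veval st e1 <= veval st e2)%R
  | BNot b1 => ~~ beval st b1
  end.

Fixpoint ncost (e : nexp) : nat :=
  match e with
  | NLit _ => 1
  | NGet _ e1 => (ncost e1).+1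
  | NAdd e1 e2 | NSub e1 e2 => (ncost e1 + ncost e2).+1
  end.

Fixpoint vcost (e : vexp) : nat :=
  match e with
  | VZero | VOne => 1
  | VGet _ e1 => (ncost e1).+1
  | VMin e1 e2 | VMax e1 e2 => (vcost e1 + vcost e2).+1
  | VCompl e1 => (vcost e1).+1
  end.

Fixpoint bcost (b : bexp) : nat :=
  match b with
  | BNLe e1 e2 => (ncost e1 + ncost e2).+1
  | BVLe e1 e2 => (vcost e1 + vcost e2).+1
  | BNot b1 => (bcost b1).+1
  end.

(* [exec c st t st'] : from store st, c terminates in store st' after t steps. *)
Inductive exec : cmd -> store R -> nat -> store R -> Prop :=
| ExSkip st : exec Skip st 1 st
| ExNSet a e x st :
    exec (NSet a e x) st (ncost e + ncost x).+1
      (Store (upd (nmem st) a (neval st e) (neval st x)) (vmem st))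
| ExVSet a e x st :
    exec (VSet a e x) st (ncost e + vcost x).+1
      (Store (nmem st) (upd (vmem st) a (neval st e) (veval st x)))
| ExSeq c1 c2 st t1 st1 t2 st2 :
    exec c1 st t1 st1 -> exec c2 st1 t2 st2 ->
    exec (Seq c1 c2) st (t1 + t2) st2
| ExIf b c1 c2 st t st1 :
    exec (if beval st b then c1 else c2) st t st1 ->
    exec (If b c1 c2) st (bcost b + t).+1 st1
| ExWhileF b c st :
    ~~ beval st b -> exec (While b c) st (bcost b).+1 st
| ExWhileT b c st t1 st1 t2 st2 :
    beval st b -> exec c st t1 st1 -> exec (While b c) st1 t2 st2 ->
    exec (While b c) st (bcost b + t1 + t2).+1 st2.

Lemma exec_det c st t1 st1 t2 st2 :
  exec c st t1 st1 -> exec c st t2 st2 -> t1 = t2 /\ st1 = st2.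
Proof.
move=> H1; elim: H1 t2 st2 => {c st t1 st1}
  [st|a e x st|a e x st|c1 c2 st t1 st1 t2 st2 _ IH1 _ IH2
  |b c1 c2 st t st1 _ IH|b c st Hb|b c st t1 st1 t2 st2 Hb _ IH1 _ IH2] t' st' H;
  inversion H as [| | |? ? ? ? st3 ? ? E1 E2|? ? ? ? ? ? E1|? ? ? N
                 |? ? ? ? st3 ? ? N E1 E2]; subst => //.
- by case: (IH1 _ _ E1) => ? ?; subst; case: (IH2 _ _ E2) => -> ->.
- by case: (IH _ _ E1) => -> ->.
- by rewrite N in Hb.
- by rewrite Hb in N.
- by case: (IH1 _ _ E1) => ? ?; subst; case: (IH2 _ _ E2) => -> ->.
Qed.

End Execution.

(** * Input and output conventions *)

(* Formulae are written in prefix (Polish) notation, one (symbol, parameter)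
   pair per connective; the parameter is the rank of an atomic proposition or
   the bound of a bounded until. *)
Fixpoint scode (AP : finType) (f : sform AP) : seq (nat * nat) :=
  match f with
  | STrue => [:: (0, 0)]
  | SAtom a => [:: (1, nat_of_ord (enum_rank a))]
  | SAnd g h => (2, 0) :: scode g ++ scode h
  | SNot g => (3, 0) :: scode g
  | SPo phi => pcode phi
  end%N
with pcode (AP : finType) (phi : pform AP) : seq (nat * nat) :=
  match phi with
  | PNext g => (4, 0) :: scode g
  | PUntil g h => (5, 0) :: scode g ++ scode h
  | PBUntil n g h => (6, n) :: scode g ++ scode h
  | PAlways g => (7, 0) :: scode g
  end%N.

Fixpoint size_scode (AP : finType) (f : sform AP) : size (scode f) = slen f
with size_pcode (AP : finType) (phi : pform AP) : size (pcode phi) = plen phi.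
Proof.
- case: f => [|a|g h|g|phi] //=.
  + by rewrite size_cat !size_scode addn1.
  + by rewrite size_scode addn1.
- case: phi => [g|g h|n g h|g] /=; rewrite ?size_cat !size_scode addn1 //.
Qed.

(* The tables of P and L are stored row by row. *)
Definition input_narrays (S AP : finType) (f : sform AP) : seq (seq nat) :=
  [:: [:: #|S|; #|AP|; size (scode f)];
      [seq c.1 | c <- scode f];
      [seq c.2 | c <- scode f]].

Definition input_varrays (R : realType) (S AP : finType) (M : gpks R S AP) :
    seq (seq R) :=
  [:: [seq gpks_P M s t | s <- enum S, t <- enum S];
      [seq gpks_I M s | s <- enum S];
      [seq gpks_L M s a | s <- enum S, a <- enum AP]].

(* Cells that hold no input contain 0. *)
Definition input_store (R : realType) (S AP : finType) (M : gpks R S AP)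
    (f : sform AP) : store R :=
  Store (fun a i => nth 0%N (nth [::] (input_narrays S f) a) i)
        (fun a i => nth 0 (nth [::] (input_varrays M) a) i).

(* The value at the state s is returned in cell [enum_rank s] of value
   array 3. *)
Definition output (R : realType) (S : finType) (st : store R) (s : S) : R :=
  vmem st 3 (enum_rank s).

(* Main.v *)
(* The value of Po(phi) at s is a max-min (bottleneck) path problem.  For a, b, x
   in [0,1]^S let

     bellman a b x s = max (a s) (min (b s) (max_t min (P s t) (x t))).

   For a threshold c > 0, the set {s | c <= bellman a b x s} is the image of
   {s | c <= x s} under a monotone operator on the subsets of S, and such an
   operator reaches its extremal fixpoints in |S| steps.  Hence |S| iterations
   from the constant 1 with a = 0 and b = ||Phi|| give the possibility of
   "always Phi": membership in a greatest fixpoint provides at every state a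
   successor to continue the path with.  For Phi = true this is the possibility
   D(s) of an infinite path from s.  The iterations from a = min ||Psi|| D with
   b = ||Phi|| give the bounded untils, and since they are stationary from the
   |S|-th on, a bound n costs only min(n, |S|) iterations.

   The program computes D once, then reads the prefix code of the formula from
   right to left, keeping the value vectors of the subformulae on a stack; each
   symbol costs at most |S| iterations of |S|^2 steps. *)
Require Import Defs.
From mathcomp Require Import all_boot all_order all_algebra.
From mathcomp Require Import classical_sets reals.
From mathcomp Require boolp.
From mathcomp Require Import zify.

Set Implicit Arguments.
Unset Strict Implicit.
Unset Printing Implicit Defensive.

Import Order.TTheory GRing.Theory Num.Theory.
Local Open Scope ring_scope.

(** * Possibility as a bottleneck fixpoint *)

Section UnitInterval.
Variables (R : realType) (I : Type).
Implicit Types (F : I -> R) (J : set I).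

Definition unit_valued F := forall i, 0 <= F i <= 1.

Lemma le_sup_image J F j : (forall i, F i <= 1) -> J j ->
  F j <= sup [set F i | i in J]%classic.
Proof.
move=> F1 Jj; apply: (@ub_le_sup _ [set F i | i in J]%classic); last by exists j.
by exists 1 => _ [i _ <-].
Qed.

(** The hypothesis [0 <= x] covers an empty [J], whose supremum is 0. *)
Lemma sup_image_le J F x : 0 <= x -> (forall j, J j -> F j <= x) ->
  sup [set F i | i in J]%classic <= x.
Proof.
move=> x0 Fx.
have [[y Jy]|/boolp.forallNP N] := boolp.pselect (exists y, [set F i | i in J]%classic y).
  by apply: ge_sup; [exists y|move=> _ [j Jj <-]; exact: Fx].
suff -> : [set F i | i in J]%classic = set0 by rewrite sup0.
by apply/seteqP; split=> // y /N.
Qed.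

Lemma le_inf_image F x (i0 : I) : (forall i, 0 <= F i) ->
  reflect (forall i, x <= F i) (x <= inf [set F i | i in setT]%classic).
Proof.
move=> F0; apply: (iffP idP) => [xF i|xF].
  apply: (le_trans xF); apply: ge_inf; last by exists i.
  by exists 0 => _ [j _ <-].
by apply: lb_le_inf; [exists (F i0), i0|move=> _ [j _ <-]].
Qed.

End UnitInterval.

Section PossibilityOfPaths.
Variables (R : realType) (S : finType) (AP : Type) (M : gpks R S AP).
Local Notation P := (gpks_P M).
Local Notation min := Order.min.
Local Notation max := Order.max.
Implicit Types (a b x g h : S -> R) (c : R) (s t : S) (pi : nat -> S).

Let P0 s t : 0 <= P s t. Proof. by case/andP: (gpks_P01 M s t). Qed.
Let P1 s t : P s t <= 1. Proof. by case/andP: (gpks_P01 M s t). Qed.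

Definition bellman a b x s :=
  max (a s) (min (b s) (\big[max/0]_t min (P s t) (x t))).

Lemma unit_valued_bellman a b x : unit_valued a -> unit_valued b ->
  unit_valued (bellman a b x).
Proof.
move=> ua ub s; rewrite /bellman le_max ge_max ge_min.
by case/andP: (ua s) => -> ->; case/andP: (ub s) => _ ->.
Qed.

Lemma unit_valued_iter_bellman k a b x : unit_valued a -> unit_valued b ->
  unit_valued x -> unit_valued (iter k (bellman a b) x).
Proof. by move=> ua ub ux; case: k => //= k; exact: unit_valued_bellman. Qed.

(** A positive threshold cannot be met by the default 0 of the maximum, so a genuine successor [t]
    must reach it. *)
Lemma le_bellman c a b x s : 0 < c ->
  (c <= bellman a b x s) =
  (c <= a s) || (c <= b s) && [exists t, (c <= P s t) && (c <= x t)].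
Proof.
move=> c0; rewrite /bellman le_max le_min; congr (_ || _ && _).
apply/boolp.bigmax_geP/existsP => [[|[t _]]|[t H]].
- by rewrite leNgt c0.
- by rewrite le_min => H; exists t.
- by right; exists t; rewrite // le_min.
Qed.

(** * Thresholds along paths and level sets of iterates *)

Definition path_above c s pi := pi 0%N = s /\ forall i, c <= P (pi i) (pi i.+1).

Lemma path_above_cons c s t pi : c <= P s t -> path_above c t pi ->
  path_above c s (fun i => if i is j.+1 then pi j else s).
Proof. by move=> st [pi0 H]; split=> // -[|i] //=; rewrite pi0. Qed.

Lemma path_above_tail c s pi : path_above c s pi ->
  path_above c (pi 1%N) (fun i => pi i.+1).
Proof. by case=> _ H; split=> // i; exact: H. Qed.

(** The infimum of the transitions of a path is the largest threshold the path stays above. Hence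
    the upper bound is only tested at that infimum when it exceeds [x], and for the lower bound one
    path reaching the threshold [x] suffices. *)
Lemma po_eq (v : (nat -> S) -> R) s (x : R) :
  0 <= x -> (forall pi, 0 <= v pi) ->
  (forall pi c, path_above c s pi -> c <= 1 -> x < c -> v pi <= x) ->
  (0 < x -> exists2 pi, path_above x s pi & x <= v pi) ->
  sup [set min (inf [set P (pi i) (pi i.+1) | i in setT]) (v pi)
      | pi in paths M s]%classic = x.
Proof.
move=> x0 v0 Hle Hge; pose e pi := inf [set P (pi i) (pi i.+1) | i in setT]%classic.
rewrite -[X in sup X]/[set min (e pi) (v pi) | pi in paths M s]%classic.
have eP pi c : reflect (forall i, c <= P (pi i) (pi i.+1)) (c <= e pi).
  exact: (@le_inf_image _ _ (fun i => P (pi i) (pi i.+1)) c 0%N).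
have e1 pi : e pi <= 1.
  by apply: (le_trans (y := P (pi 0%N) (pi 1%N))) => //; apply/(eP pi).
apply/eqP; rewrite eq_le; apply/andP; split.
  apply: sup_image_le => // pi [pi0 _]; rewrite ge_min.
  case: (leP (e pi) x) => //= xe; apply: (Hle _ (e pi)) => //.
  by split=> //; apply/eP.
have le1 pi : min (e pi) (v pi) <= 1 by rewrite ge_min e1.
have [x_gt0|] := ltP 0 x.
  have [pi [pi0 piP] xv] := Hge x_gt0.
  apply: (le_trans (y := min (e pi) (v pi))); first by rewrite le_min xv andbT; apply/eP.
  apply: (le_sup_image (F := fun pi => min (e pi) (v pi))) => //.
  by split=> // i; apply: lt_le_trans (piP i).
(* For [x <= 0] only nonnegativity of the supremum is left; it holds also without any path, by
   [sup set0 = 0]. *)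
move=> /le_trans; apply.
have [[pi Hpi]|/boolp.forallNP N] := boolp.pselect (exists pi, paths M s pi).
  apply: (le_trans (y := min (e pi) (v pi))).
    by rewrite le_min v0 andbT; apply/eP.
  by apply: (le_sup_image (F := fun pi => min (e pi) (v pi))).
suff -> : paths M s = set0 by rewrite image_set0 sup0.
by apply/seteqP; split=> // y /N.
Qed.

(* [c <= x s] for a positive threshold [c] turns [bellman] into the monotone
   operator [level_step] on sets of states. *)
Definition level c x : {set S} := [set s | c <= x s].

Definition level_step c a b (U : {set S}) : {set S} :=
  [set s | (c <= a s) || (c <= b s) && [exists t, (c <= P s t) && (t \in U)]].

Lemma level_bellman c a b x : 0 < c ->
  level c (bellman a b x) = level_step c a b (level c x).
Proof.
move=> c0; apply/setP=> s; rewrite !inE le_bellman //.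
by congr (_ || _ && _); apply: eq_existsb => t; rewrite inE.
Qed.

Lemma level_iter_bellman c k a b x : 0 < c ->
  level c (iter k (bellman a b) x) = iter k (level_step c a b) (level c x).
Proof. by move=> c0; elim: k => //= k <-; rewrite level_bellman. Qed.

Lemma level_step_mono c a b :
  {homo level_step c a b : U V / U \subset V}.
Proof.
move=> U V /fintype.subsetP UV; apply/fintype.subsetP => s; rewrite !inE.
case/orP=> [->//|/andP[-> /existsP[t /andP[Pst tU]]]].
by apply/orP; right; apply/existsP; exists t; rewrite Pst UV.
Qed.

Lemma bellman_0 a b : unit_valued a -> bellman a b (fun=> 0) =1 a.
Proof.
move=> ua s; have /andP[a0 _] := ua s; rewrite /bellman.
apply/max_idPl; rewrite ge_min; apply/orP; right.
by apply: bigmax_le => // t _; rewrite ge_min a0 orbT.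
Qed.

Lemma level_0 c : 0 < c -> level c (fun=> 0) = finset.set0.
Proof. by move=> c0; apply/setP => s; rewrite !inE leNgt c0. Qed.

(* Least fixpoint: the iteration from [a] is the iteration from 0 shifted by
   one, and level sets only grow [#|S|] times. *)
Lemma iter_bellman_stable k a b s : unit_valued a ->
  iter k (bellman a b) a s <= iter #|S| (bellman a b) a s.
Proof.
move=> ua; rewrite leNgt; apply/negP.
have aE : a = bellman a b (fun=> 0) by apply: boolp.funext => t; rewrite bellman_0.
set xk := iter k _ _; set xn := iter #|S| _ _ => lt.
have c0 : 0 < xk s.
  apply: le_lt_trans lt; rewrite /xn; case: #|S| => [|m] /=.
    by case/andP: (ua s).
  by rewrite le_max; case/andP: (ua s) => ->.
(* The larger value itself serves as the threshold separating the two iterates at [s]. *)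
pose c := xk s; suff : s \in level c xk -> s \in level c xn.
  by rewrite !inE lexx => /(_ isT); rewrite leNgt lt.
have lev m : level c (iter m (bellman a b) a) =
    iter m.+1 (level_step c a b) finset.set0.
  by rewrite {2}aE -iterSr level_iter_bellman // level_0.
(* From the empty set, |S| steps already give the least fixpoint; the extra step leaves it
   unchanged, and every iterate is contained in it. *)
rewrite !lev iterS [in X in _ -> X]iterS fixsetK; last exact: level_step_mono.
by apply/fintype.subsetP; apply: (iter_sub_fix (@level_step_mono c a b) k.+1).
Qed.

(** [cofixset] is defined by complementing the least fixpoint of the dual operator; this identifies
    it with the iteration from the full set. *)
Lemma iter_funsetC (F : {set S} -> {set S}) k :
  iter k (funsetC F) finset.set0 = ~: iter k F [set: S].
Proof. by elim: k => /= [|k ->]; rewrite ?finset.setCT // /funsetC finset.setCK. Qed.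

(** * The greatest fixpoint and infinite paths above a threshold *)

Definition always_iter b := iter #|S| (bellman (fun=> 0) b) (fun=> 1).

(** The level set [U] is a greatest fixpoint, so each of its states satisfies [b] to degree [c] and
    has a successor in [U] by a transition of at least [c]. Repeatedly choosing such a successor
    yields the path. *)
Lemma le_always_iter c b s : 0 < c -> c <= 1 -> c <= always_iter b s ->
  exists2 pi, path_above c s pi & forall i, c <= b (pi i).
Proof.
move=> c0 c1; set F := level_step c (fun=> 0) b.
pose U := level c (always_iter b).
have UF : F U = U.
  have -> : U = cofixset F.
    rewrite /cofixset /fixset iter_funsetC finset.setCK /U level_iter_bellman //.
    (* Because [c <= 1], the level set of the constant 1 is the full set. *)
    by congr iter; apply/setP => t; rewrite !inE.
  by rewrite cofixsetK //; exact: level_step_mono.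
have step t : t \in U -> (c <= b t) && [exists u, (c <= P t u) && (u \in U)].
  by rewrite -{1}UF inE leNgt c0.
pose next t := odflt t [pick u | (c <= P t u) && (u \in U)].
have nextP t : t \in U -> c <= P t (next t) /\ next t \in U.
  move=> /step /andP[_ /existsP[u Hu]]; rewrite /next.
  by case: pickP => [w /andP[]//|/(_ u)]; rewrite Hu.
move=> sU; have iU i : iter i next s \in U.
  by elim: i => [|i IH]; [rewrite inE|case: (nextP _ IH)].
exists (fun i => iter i next s).
  by split=> // i; case: (nextP _ (iU i)).
by move=> i; case/andP: (step _ (iU i)).
Qed.

(** Holds for any number of iterations: each one consumes the first state of the path and passes to
    the tail. *)
Lemma always_iter_ge c b s pi : 0 < c -> c <= 1 -> path_above c s pi ->
  (forall i, c <= b (pi i)) -> c <= always_iter b s.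
Proof.
move=> c0 c1; rewrite /always_iter; move: #|S| => k.
elim: k s pi => //= k IH s pi Hpi bpi; rewrite le_bellman //; apply/orP; right.
have [pi0 piP] := Hpi; rewrite -{1}pi0 bpi /=; apply/existsP; exists (pi 1%N).
by rewrite -pi0 piP; apply: (IH _ _ (path_above_tail Hpi)).
Qed.

(** * Infinite continuations and the iteration for until *)

Definition alive := always_iter (fun=> 1).

Lemma unit_valued_cst1 : unit_valued (fun _ : S => 1 : R).
Proof. by move=> s; rewrite ler01 lexx. Qed.

Lemma unit_valued_cst0 : unit_valued (fun _ : S => 0 : R).
Proof. by move=> s; rewrite ler01 lexx. Qed.

Lemma unit_valued_min g h : unit_valued g -> unit_valued h ->
  unit_valued (fun s => min (g s) (h s)).
Proof.
move=> ug uh s; rewrite le_min ge_min.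
by case/andP: (ug s) => -> ->; case/andP: (uh s) => ->.
Qed.

Lemma unit_valued_always_iter b : unit_valued b -> unit_valued (always_iter b).
Proof.
move=> ub; apply: unit_valued_iter_bellman => //.
  exact: unit_valued_cst0.
exact: unit_valued_cst1.
Qed.

(** The vector [min g alive] is the possibility of stopping here: [g] holds and the path can still
    be prolonged forever, as Po ranges over infinite paths only. *)
Definition until_iter k f g :=
  iter k (bellman (fun s => min (g s) (alive s)) f)
    (fun s => min (g s) (alive s)).

Lemma unit_valued_until_iter k f g : unit_valued f -> unit_valued g ->
  unit_valued (until_iter k f g).
Proof.
move=> uf ug.
have ua : unit_valued alive by apply/unit_valued_always_iter/unit_valued_cst1.
by apply: unit_valued_iter_bellman => //; apply: unit_valued_min.
Qed.

Lemma until_iter_ge c k j f g s pi : 0 < c -> c <= 1 -> path_above c s pi ->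
  (j <= k)%N -> (forall i, (i < j)%N -> c <= f (pi i)) -> c <= g (pi j) ->
  c <= until_iter k f g s.
Proof.
move=> c0 c1; elim: k j s pi => [|k IH] [|j] s pi Hpi // jk fc gc.
- have [<- _] := Hpi; rewrite /= le_min gc /=.
  by apply: (always_iter_ge (pi := pi)) => //; case: Hpi.
- rewrite /= le_bellman //; apply/orP; left; rewrite le_min.
  have [<- _] := Hpi; rewrite gc.
  by apply: (always_iter_ge (pi := pi)) => //; case: Hpi.
- rewrite /= le_bellman //; apply/orP; right.
  have [pi0 piP] := Hpi; rewrite -{1}pi0 fc //=; apply/existsP; exists (pi 1%N).
  rewrite -pi0 piP; apply: (IH j _ _ (path_above_tail Hpi)) => // i ij.
  exact: fc.
Qed.

(** Unrolling the iterate, either the stopping vector meets the threshold, and [alive] supplies the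
    infinite path, or a transition is prepended to the path of the successor. *)
Lemma le_until_iter c k f g s : 0 < c -> c <= 1 -> c <= until_iter k f g s ->
  exists pi j, [/\ path_above c s pi, (j <= k)%N,
    forall i, (i < j)%N -> c <= f (pi i) & c <= g (pi j)].
Proof.
move=> c0 c1.
have base t : c <= min (g t) (alive t) -> exists pi j, [/\ path_above c t pi,
    (j <= 0)%N, forall i, (i < j)%N -> c <= f (pi i) & c <= g (pi j)].
  rewrite le_min => /andP[ct /(le_always_iter c0 c1)[pi Hpi _]].
  by exists pi, 0%N; split=> //; case: Hpi => ->.
elim: k s => [|k IH] s /=; first exact: base.
rewrite le_bellman // => /orP[/base[pi [j [? j0 ? ?]]]|].
  by exists pi, j; split=> //; apply: leq_trans j0 _.
move=> /andP[fs /existsP[t /andP[st /IH[pi [j [Hpi jk fj gj]]]]]].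
exists (fun i => if i is i'.+1 then pi i' else s), j.+1; split=> //.
  exact: path_above_cons Hpi.
by case=> [|i] //; exact: fj.
Qed.

(** A path witnessing the value after [j] iterations also witnesses it for the weaker bound [k]. *)
Lemma until_iter_le j k f g s : unit_valued f -> unit_valued g ->
  (j <= k)%N -> until_iter j f g s <= until_iter k f g s.
Proof.
move=> uf ug jk.
have /andP[k0 _] := unit_valued_until_iter k uf ug s.
have /andP[_ j1] := unit_valued_until_iter j uf ug s.
have [j0|] := ltP 0 (until_iter j f g s); last by move/le_trans; apply.
have [pi [i [Hpi ij fi gi]]] := le_until_iter j0 j1 (lexx _).
exact: (until_iter_ge j0 j1 Hpi (leq_trans ij jk)).
Qed.

Lemma until_iter_stable k f g s : unit_valued g ->
  until_iter k f g s <= until_iter #|S| f g s.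
Proof.
move=> ug; apply: iter_bellman_stable; apply: unit_valued_min => //.
exact/unit_valued_always_iter/unit_valued_cst1.
Qed.

(** * Temporal operators as Bellman iterations *)

Lemma le_until_at c f g pi j : c <= 1 ->
  (forall i, c <= P (pi i) (pi i.+1)) ->
  reflect ((forall i, (i < j)%N -> c <= f (pi i)) /\ c <= g (pi j))
    (c <= until_at M f g pi j).
Proof.
move=> c1 piP; rewrite /until_at !le_min.
have -> : c <= \big[min/1]_(1 <= k < j.+1) P (pi k.-1) (pi k).
  by rewrite big_nat; apply: le_bigmin => // -[//|i] _; exact: piP.
rewrite andbT; apply: (iffP andP) => -[fc gc]; split=> //.
  move=> i ij; apply: (le_trans fc); apply: ge_bigmin_seq => //.
  by rewrite mem_index_iota.
by rewrite big_nat; apply: le_bigmin => // i /andP[_ ij]; exact: fc.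
Qed.

Lemma unit_valued_until_at f g pi : unit_valued f -> unit_valued g ->
  unit_valued (until_at M f g pi).
Proof.
move=> uf ug j; apply/andP; split; last first.
  by rewrite ge_min orbC; case/andP: (ug (pi j)) => _ ->.
apply/le_until_at => //; split=> [i _|].
  by case/andP: (uf (pi i)).
by case/andP: (ug (pi j)).
Qed.

Lemma po_until f g (J : set nat) m s : unit_valued f -> unit_valued g ->
  (forall j, (0 < j <= m)%N -> J j) ->
  (forall j, J j -> until_iter j f g s <= until_iter m f g s) ->
  sup [set min (inf [set P (pi i) (pi i.+1) | i in setT])
           (max (g (pi 0%N)) (sup [set until_at M f g pi j | j in J]))
      | pi in paths M s]%classic = until_iter m f g s.
Proof.
move=> uf ug mJ Jm; have /andP[x0 x1] := unit_valued_until_iter m uf ug s.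
have until_le1 pi j : until_at M f g pi j <= 1.
  by case/andP: (unit_valued_until_at pi uf ug j).
apply: (po_eq (v := fun pi => max _ _)) => //.
- by move=> pi; rewrite le_max; case/andP: (ug (pi 0%N)) => ->.
- move=> pi c Hpi c1 xc.
  have bound j : (until_iter j f g s <= until_iter m f g s) ->
      until_at M f g pi j <= until_iter m f g s.
    move=> jm; rewrite leNgt; apply/negP => lt.
    (* The minimum [d] is a common threshold for the transitions and the until value; it exceeds the
       iterate although the path shows that the iterate reaches it. *)
    have : until_iter m f g s < min c (until_at M f g pi j).
      by rewrite lt_min xc.
    set d := min _ _ => xd.
    have Hd : path_above d s pi.
      by case: Hpi => ? piP; split=> // i; rewrite ge_min piP.
    have d1 : d <= 1 by rewrite ge_min c1.
    have /(le_until_at _ _ _ d1)[|fd gd] : d <= until_at M f g pi j.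
      + by rewrite ge_min lexx orbT.
      + by case: Hd.
    have := until_iter_ge (le_lt_trans x0 xd) d1 Hd (leqnn j) fd gd.
    by move/le_trans => /(_ _ jm); rewrite leNgt xd.
  rewrite ge_max; apply/andP; split.
    (* Position 0 is the separate term of the semantics; there both meets are empty and equal 1. *)
    have := bound 0%N (until_iter_le _ uf ug (leq0n m)).
    rewrite /until_at !big_nil !minxx; apply: le_trans.
    by rewrite le_min lexx andbT; case/andP: (ug (pi 0%N)).
  by apply: sup_image_le => // j /Jm; exact: bound.
- move=> x_gt0.
  have [pi [j [Hpi jm fj gj]]] := le_until_iter x_gt0 x1 (lexx _).
  exists pi => //; rewrite le_max; case: j => [|j] in jm fj gj *.
    by rewrite gj.
  apply/orP; right; apply: (le_trans (y := until_at M f g pi j.+1)).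
    by apply/le_until_at => //; case: Hpi.
  by apply: le_sup_image => //; exact: mJ.
Qed.

Lemma sem_until (f g : sform AP) s :
  unit_valued (sem M f) -> unit_valued (sem M g) ->
  sem M (SPo (PUntil f g)) s = until_iter #|S| (sem M f) (sem M g) s.
Proof.
move=> uf ug; apply: po_until => // j; first by case/andP.
by move=> _; exact: until_iter_stable.
Qed.

Lemma sem_buntil n (f g : sform AP) s :
  unit_valued (sem M f) -> unit_valued (sem M g) ->
  sem M (SPo (PBUntil n f g)) s =
  until_iter (minn n #|S|) (sem M f) (sem M g) s.
Proof.
move=> uf ug; apply: po_until => // j.
  by case/andP=> j0; rewrite leq_min => /andP[jn _]; apply/andP.
case/andP=> _ jn; case: (leqP n #|S|) => _; first exact: until_iter_le.
exact: until_iter_stable.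
Qed.

Lemma sem_always (g : sform AP) s : unit_valued (sem M g) ->
  sem M (SPo (PAlways g)) s = always_iter (sem M g) s.
Proof.
move=> ug; have /andP[x0 x1] := unit_valued_always_iter ug s.
have v0 pi i :
    0 <= min (\big[min/1]_(0 <= j < i) P (pi j) (pi j.+1)) (sem M g (pi i)).
  rewrite le_min; case/andP: (ug (pi i)) => -> _; rewrite andbT.
  by apply: le_bigmin => // j _; exact: P0.
apply: (po_eq (v := psem M (PAlways g))) => //=.
- by move=> pi; apply/(le_inf_image _ 0%N (v0 pi)).
- move=> pi c Hpi c1 xc; rewrite leNgt; apply/negP => lt.
  set v := inf _ in lt; have : always_iter (sem M g) s < min c v.
    by rewrite lt_min xc.
  set d := min _ _ => xd.
  have d1 : d <= 1 by rewrite ge_min c1.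
  have /(le_inf_image _ 0%N (v0 pi)) dv : d <= v by rewrite ge_min lexx orbT.
  suff : d <= always_iter (sem M g) s by rewrite leNgt xd.
  apply: (always_iter_ge (pi := pi)) => //; first exact: le_lt_trans xd.
    by case: Hpi => ? piP; split=> // i; rewrite ge_min piP.
  by move=> i; have := dv i; rewrite le_min => /andP[].
- move=> x_gt0; have [pi Hpi gpi] := le_always_iter x_gt0 x1 (lexx _).
  exists pi => //; apply/(le_inf_image _ 0%N (v0 pi)) => i.
  by rewrite le_min gpi andbT; apply: le_bigmin => // j _; case: Hpi.
Qed.

(** One Bellman step with [a = 0] and [b = 1] forces exactly one transition, after which [alive]
    continues the path. *)
Lemma sem_next (g : sform AP) s : unit_valued (sem M g) ->
  sem M (SPo (PNext g)) s =
  bellman (fun=> 0) (fun=> 1) (fun t => min (sem M g t) (alive t)) s.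
Proof.
move=> ug; set x := bellman _ _ _.
have /andP[x0 x1] : 0 <= x s <= 1.
  by apply: unit_valued_bellman; [exact: unit_valued_cst0|exact: unit_valued_cst1].
apply: (po_eq (v := psem M (PNext g))) => //=.
- by move=> pi; rewrite le_min P0; case/andP: (ug (pi 1%N)).
- move=> pi c Hpi c1 xc; rewrite ge_min; apply/orP; right.
  rewrite leNgt; apply/negP => lt.
  have : x s < min c (sem M g (pi 1%N)) by rewrite lt_min xc.
  set d := min _ _ => xd.
  have d1 : d <= 1 by rewrite ge_min c1.
  have d0 : 0 < d by exact: le_lt_trans xd.
  have Hd : path_above d s pi.
    by case: Hpi => ? piP; split=> // i; rewrite ge_min piP.
  suff : d <= x s by rewrite leNgt xd.
  rewrite le_bellman //; apply/orP; right; rewrite d1 /=.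
  apply/existsP; exists (pi 1%N); case: (Hd) => <- ->; rewrite le_min.
  rewrite ge_min lexx orbT /=.
  exact: (always_iter_ge d0 d1 (path_above_tail Hd)).
- move=> x_gt0; have := lexx (x s); rewrite le_bellman // => /orP[|/andP[_]].
    by rewrite leNgt x_gt0.
  case/existsP=> t /andP[st]; rewrite le_min => /andP[gt].
  case/(le_always_iter x_gt0 x1) => pi Hpi _.
  exists (fun i => if i is j.+1 then pi j else s).
    exact: path_above_cons Hpi.
  by case: Hpi => -> _; rewrite le_min st.
Qed.

End PossibilityOfPaths.

(* Values of formulae lie in the unit interval *)
Scheme sform_pform_ind := Induction for sform Sort Prop
  with pform_sform_ind := Induction for pform Sort Prop.

Lemma unit_valued_sem (R : realType) (S : finType) (AP : Type)
  (M : gpks R S AP) (f : sform AP) : unit_valued (sem M f).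
Proof.
(* The predicate for a path formula speaks of its possibility, so the case of [SPo] is immediate and
   each temporal operator is treated through its iteration. *)
apply: (sform_pform_ind (P := fun f => unit_valued (sem M f))
  (P0 := fun phi => unit_valued (sem M (SPo phi)))) f => //.
- exact: unit_valued_cst1.
- by move=> a s; exact: gpks_L01.
- by move=> g ug h uh; exact: unit_valued_min.
- by move=> g ug s; rewrite subr_ge0 gerBl andbC; exact: ug.
- move=> g ug s; rewrite sem_next //.
  by apply: unit_valued_bellman; [exact: unit_valued_cst0|exact: unit_valued_cst1].
- by move=> g ug h uh s; rewrite sem_until //; exact: unit_valued_until_iter.
- by move=> n g ug h uh s; rewrite sem_buntil //; exact: unit_valued_until_iter.
- by move=> g ug s; rewrite sem_always //; exact: unit_valued_always_iter.
Qed.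

(** * Total correctness with a bound on the running time *)

Local Open Scope nat_scope.

Section Hoare.
Variable R : realType.
Implicit Types (st : store R) (c : cmd) (Q : store R -> Prop) (ns vs : seq nat).

(** Asking for one terminating run is enough, since [exec] is deterministic by [exec_det]. *)
Definition total c st T Q :=
  exists t st', [/\ exec c st t st', t <= T & Q st'].

Fixpoint nmods c : seq nat :=
  match c with
  | Skip | VSet _ _ _ => [::]
  | NSet a _ _ => [:: a]
  | Seq c1 c2 | If _ c1 c2 => nmods c1 ++ nmods c2
  | While _ c1 => nmods c1
  end.

Fixpoint vmods c : seq nat :=
  match c with
  | Skip | NSet _ _ _ => [::]
  | VSet a _ _ => [:: a]
  | Seq c1 c2 | If _ c1 c2 => vmods c1 ++ vmods c2
  | While _ c1 => vmods c1
  end.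

Definition framed ns vs st st' :=
  (forall a, a \notin ns -> nmem st' a = nmem st a) /\
  (forall a, a \notin vs -> vmem st' a = vmem st a).

Lemma framed_trans ns vs st1 st2 st3 :
  framed ns vs st1 st2 -> framed ns vs st2 st3 -> framed ns vs st1 st3.
Proof.
by move=> [n1 v1] [n2 v2]; split=> a ha; rewrite (n2, v2) // (n1, v1).
Qed.

Lemma framed_sub ns vs ns' vs' st st' : {subset ns <= ns'} ->
  {subset vs <= vs'} -> framed ns vs st st' -> framed ns' vs' st st'.
Proof.
move=> sn sv [n v]; split=> a ha; [apply: n|apply: v].
  by apply: contra ha => /sn.
by apply: contra ha => /sv.
Qed.

(** Membership in the syntactic lists [nmods] and [vmods] is decided by computation, so that later
    frame conditions are proved by [isT]. *)
Lemma exec_framed c st t st' :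
  exec c st t st' -> framed (nmods c) (vmods c) st st'.
Proof.
elim=> {c st t st'} //.
- move=> a e x st; split=> //= b; rewrite inE => /negbTE ba.
  by rewrite /upd ba.
- move=> a e x st; split=> //= b; rewrite inE => /negbTE ba.
  by rewrite /upd ba.
- move=> c1 c2 st t1 st1 t2 st2 _ IH1 _ IH2; apply: framed_trans.
    by apply: framed_sub IH1 => a; rewrite mem_cat => ->.
  by apply: framed_sub IH2 => a; rewrite mem_cat orbC => ->.
- move=> b c1 c2 st t st1 _.
  by case: ifP => _; apply: framed_sub => a; rewrite mem_cat => ->; rewrite ?orbT.
- by move=> b c st t1 st1 t2 st2 _ _ IH1 _ IH2; exact: framed_trans IH2.
Qed.

(** The frame is handed over together with the postcondition; specifications therefore only mention
    what a command changes. *)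
Lemma total_weaken c st T T' Q Q' : total c st T Q -> T <= T' ->
  (forall st', framed (nmods c) (vmods c) st st' -> Q st' -> Q' st') ->
  total c st T' Q'.
Proof.
move=> [t [st' [H tT q]]] TT QQ; exists t, st'; split=> //.
  exact: leq_trans TT.
by apply: QQ => //; apply: exec_framed H.
Qed.

Lemma total_nset a e x st T Q : (ncost e + ncost x).+1 <= T ->
  Q (Store (upd (nmem st) a (neval st e) (neval st x)) (vmem st)) ->
  total (NSet a e x) st T Q.
Proof. by move=> cT q; do 2 eexists; split; [constructor| |exact: q]. Qed.

Lemma total_vset a e x st T Q : (ncost e + vcost x).+1 <= T ->
  Q (Store (nmem st) (upd (vmem st) a (neval st e) (veval st x))) ->
  total (VSet a e x) st T Q.
Proof. by move=> cT q; do 2 eexists; split; [constructor| |exact: q]. Qed.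

Lemma total_seq T1 T2 c1 c2 st T Q :
  total c1 st T1 (fun st1 => total c2 st1 T2 Q) -> T1 + T2 <= T ->
  total (Seq c1 c2) st T Q.
Proof.
move=> [t1 [st1 [H1 h1 [t2 [st2 [H2 h2 q]]]]]] le.
exists (t1 + t2), st2; split=> //; first exact: ExSeq H2.
exact: leq_trans (leq_add h1 h2) le.
Qed.

Lemma total_if b c1 c2 st T T' Q :
  total (if beval st b then c1 else c2) st T Q -> (bcost b + T).+1 <= T' ->
  total (If b c1 c2) st T' Q.
Proof.
move=> [t [st1 [H h q]]] le; exists (bcost b + t).+1, st1; split=> //.
  exact: ExIf.
by apply: leq_trans le; rewrite ltnS leq_add2l.
Qed.

Lemma total_while_true T1 T2 b c st T Q : beval st b ->
  total c st T1 (fun st1 => total (While b c) st1 T2 Q) ->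
  (bcost b + T1 + T2).+1 <= T -> total (While b c) st T Q.
Proof.
move=> hb [t1 [st1 [H1 h1 [t2 [st2 [H2 h2 q]]]]]] le.
exists (bcost b + t1 + t2).+1, st2; split=> //; first exact: ExWhileT H2.
by apply: leq_trans le; rewrite ltnS leq_add // leq_add2l.
Qed.

Lemma total_while_false b c st T Q : ~~ beval st b -> bcost b < T -> Q st ->
  total (While b c) st T Q.
Proof. by move=> hb le q; do 2 eexists; split; [exact: ExWhileF| |]. Qed.

(** * Counting loops *)

Definition nvar a := NGet a (NLit 0).

(** Here [b] names the scalar that holds the bound, read again at every test. *)
Definition for_ i b c :=
  Seq (NSet i (NLit 0) (NLit 0))
    (While (BNot (BNLe (nvar b) (nvar i)))
      (Seq c (NSet i (NLit 0) (NAdd (nvar i) (NLit 1))))).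

Definition setn st i v :=
  Store (upd (nmem st) i 0 v) (vmem st).

(** Induction on the number of remaining rounds. The 13 is 7 for a successful test and 6 for the
    increment; the 10 is 3 for the initialisation and 7 for the final test. *)
Lemma total_for (Inv : nat -> store R -> Prop) (N i b : nat) c st T T' Q :
  [&& i != b, b \notin nmods c & i \notin nmods c] -> nmem st b 0 = N ->
  (forall k st' v, Inv k st' -> Inv k (setn st' i v)) ->
  Inv 0 st ->
  (forall k st', k < N -> nmem st' i 0 = k ->
    framed (nmods (for_ i b c)) (vmods (for_ i b c)) st st' -> Inv k st' ->
    total c st' T (Inv k.+1)) ->
  10 + N * (T + 13) <= T' ->
  (forall st', framed (nmods (for_ i b c)) (vmods (for_ i b c)) st st' ->
    Inv N st' -> Q st') ->
  total (for_ i b c) st T' Q.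
Proof.
case/and3P=> ib bc ic stN Istab I0 Istep leT IQ.
set ns := nmods (for_ i b c); set vs := vmods (for_ i b c).
have subn : {subset nmods c <= ns}.
  by move=> a; rewrite /ns /= inE mem_cat => ->; rewrite orbT.
have subv : {subset vmods c <= vs}.
  by move=> a; rewrite /vs /= cats0.
have fset st' v : framed ns vs st' (setn st' i v).
  split=> //= a; rewrite /ns /= inE negb_or => /andP[/negbTE ai _].
  by rewrite /upd ai.
have bns : b \notin ns.
  by rewrite /ns /= in_cons mem_cat mem_seq1 !negb_or bc eq_sym ib.
have loop r k st' : k + r = N -> nmem st' i 0 = k -> framed ns vs st st' ->
    Inv k st' ->
    total (While (BNot (BNLe (nvar b) (nvar i)))
      (Seq c (NSet i (NLit 0) (NAdd (nvar i) (NLit 1))))) st'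
      (7 + r * (T + 13)) (fun st' => framed ns vs st st' /\ Inv N st').
  elim: r k st' => [|r IH] k st' krN ik fr Ik.
    rewrite addn0 in krN; subst k.
    apply: total_while_false; last by split=> //; rewrite -krN.
      by rewrite /= (proj1 fr) // stN krN negbK.
    by rewrite /=; lia.
  apply: (@total_while_true (T + 6) (7 + r * (T + 13))).
  - by rewrite /= (proj1 fr) // stN ik -ltnNge; lia.
  - apply: (@total_seq T 6) => //.
    have kN : k < N by lia.
    apply: total_weaken (Istep k st' kN ik fr Ik) _ _ => // st1 fr1 I1.
    have ik1 : nmem st1 i 0 = k by rewrite (proj1 fr1).
    apply: total_nset => //=; rewrite ik1 addn1 -/(setn st1 i k.+1).
    apply: (IH k.+1) => /=.
    + lia.
    + by rewrite /upd !eqxx.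
    + apply: framed_trans fr _; apply: framed_trans (fset _ _).
      exact: framed_sub fr1.
    + exact: Istab.
  - by rewrite /=; lia.
apply: (@total_seq 3 (7 + N * (T + 13))); last lia.
apply: total_nset => //=; rewrite -/(setn st i 0).
apply: total_weaken (loop N 0 _ _ _ _ _) _ _ => //=; last by move=> st' _ []; exact: IQ.
- by rewrite /upd !eqxx.
- exact: Istab.
Qed.
End Hoare.

(** * The model checker *)

(* Number arrays: 0-2 input, 3 position in the code, 4 top of the stack (the
   number of stacked values), 5-6 states, 7 a running table index, 8 number of
   iterations, 9 iteration counter.  Value arrays: 0-2 input, 3 output, 4 stack,
   5 the possibility D of an infinite path, 6-8 the vectors a, b, x of
   [bellman], 9 its result, 10 an accumulator. *)
Definition inner_loop : cmd :=
  for_ 6 0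
    (Seq (VSet 10 (NLit 0)
            (VMax (VGet 10 (NLit 0)) (VMin (VGet 0 (nvar 7)) (VGet 8 (nvar 6)))))
         (NSet 7 (NLit 0) (NAdd (nvar 7) (NLit 1)))).

(** Scalar 7 runs through the whole table of P without being reset between rows, which avoids a
    multiplication the machine does not have. *)
Definition row_loop : cmd :=
  for_ 5 0
    (Seq (VSet 10 (NLit 0) VZero)
      (Seq inner_loop
        (VSet 9 (nvar 5)
          (VMax (VGet 6 (nvar 5)) (VMin (VGet 7 (nvar 5)) (VGet 10 (NLit 0))))))).

(** The new vector is completed in array 9 before array 8 is overwritten, because every row reads
    the old one. *)
Definition copy_loop : cmd := for_ 5 0 (VSet 8 (nvar 5) (VGet 9 (nvar 5))).

Definition bellman_cmd : cmd :=
  Seq (NSet 7 (NLit 0) (NLit 0)) (Seq row_loop copy_loop).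

Definition iter_cmd : cmd := for_ 9 8 bellman_cmd.

(** * Correctness and cost of one Bellman iteration *)

Section BellmanCommand.
Variable R : realType.
Local Notation min := Order.min.
Local Notation max := Order.max.
Implicit Types st : store R.

Definition acc_max (F : nat -> R) k : R :=
  foldl (fun r t => max r (F t)) 0%R (iota 0 k).

Lemma acc_maxS F k : acc_max F k.+1 = max (acc_max F k) (F k).
Proof. by rewrite /acc_max -addn1 iotaD foldl_cat. Qed.

Lemma total_inner_loop st n q : nmem st 0 0 = n -> nmem st 7 0 = q ->
  vmem st 10 0 = 0%R ->
  total inner_loop st (10 + n * 31)
    (fun st' => nmem st' 7 0 = q + n /\ vmem st' 10 0 =
      acc_max (fun t => min (vmem st 0 (q + t)) (vmem st 8 t)) n).
Proof.
move=> stn stq st0.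
set F := fun t : nat => min _ _.
apply: (total_for (N := n) (T := 18) (Inv := fun k st' =>
  nmem st' 7 0 = q + k /\ vmem st' 10 0 = acc_max F k)) => //.
- by rewrite addn0.
- move=> k st' kn ik fr [st'q st'a].
  apply: (total_seq (T1 := 12) (T2 := 6)) => //; apply: total_vset => //=.
  apply: total_nset => //=; rewrite /upd !eqxx /=; split.
    by rewrite st'q; lia.
  by rewrite acc_maxS st'a st'q ik (proj2 fr 0 isT) (proj2 fr 8 isT).
Qed.

Lemma total_row_loop st n : nmem st 0 0 = n -> nmem st 7 0 = 0 ->
  total row_loop st (10 + n * (n * 31 + 50))
    (fun st' => forall j, j < n -> vmem st' 9 j =
      max (vmem st 6 j) (min (vmem st 7 j)
        (acc_max (fun t => min (vmem st 0 (j * n + t)) (vmem st 8 t)) n))).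
Proof.
move=> stn st0; pose F j := max (vmem st 6 j) (min (vmem st 7 j)
  (acc_max (fun t => min (vmem st 0 (j * n + t)) (vmem st 8 t)) n)).
apply: (total_for (N := n) (T := n * 31 + 37) (Inv := fun k st' =>
  nmem st' 7 0 = k * n /\ forall j, j < k -> vmem st' 9 j = F j)) => //.
- move=> k st' kn ik fr [st'q st'F].
  apply: (total_seq (T1 := 3) (T2 := n * 31 + 34)); last lia.
  apply: total_vset => //; set st1 := Store _ _.
  have st1n : nmem st1 0 0 = n by rewrite -stn -(proj1 fr 0 isT).
  have st1q : nmem st1 7 0 = k * n by [].
  apply: (total_seq (T1 := 10 + n * 31) (T2 := 20)); last lia.
  apply: total_weaken (total_inner_loop st1n st1q _) (leqnn _) _ => //.
  move=> st2 fr2 [st2q st2a].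
  apply: total_vset => //=.
  have -> : nmem st2 5 0 = k by rewrite (proj1 fr2 5 isT).
  split; first by rewrite st2q; lia.
  move=> j; rewrite ltnS leq_eqVlt /upd eqxx /=; case: eqP => [-> _|_ /= jk].
    rewrite st2a (proj2 fr2 6 isT) (proj2 fr2 7 isT) /F /=.
    rewrite -(proj2 fr 6 isT) -(proj2 fr 7 isT).
    by rewrite -(proj2 fr 0 isT) -(proj2 fr 8 isT).
  by rewrite (proj2 fr2 9 isT) -(st'F _ jk).
- lia.
- by move=> st' _ [].
Qed.

Lemma total_copy_loop st n : nmem st 0 0 = n ->
  total copy_loop st (10 + n * 20)
    (fun st' => forall j, j < n -> vmem st' 8 j = vmem st 9 j).
Proof.
move=> stn; apply: (total_for (N := n) (T := 7) (Inv := fun k st' =>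
  forall j, j < k -> vmem st' 8 j = vmem st 9 j)) => //.
- move=> k st' kn ik fr IH; apply: total_vset => //= j.
  rewrite /upd /= ik ltnS leq_eqVlt (proj2 fr 9 isT).
  by case: eqP => [->|_ /=] //; exact: IH.
Qed.

Lemma total_bellman_cmd st n : nmem st 0 0 = n -> 0 < n ->
  total bellman_cmd st (200 * (n * n))
    (fun st' => forall j, j < n -> vmem st' 8 j =
      max (vmem st 6 j) (min (vmem st 7 j)
        (acc_max (fun t => min (vmem st 0 (j * n + t)) (vmem st 8 t)) n))).
Proof.
move=> stn n0.
apply: (total_seq (T1 := 3) (T2 := 10 + n * (n * 31 + 50) + (10 + n * 20))); last nia.
apply: total_nset => //.
apply: total_seq (leqnn _).
apply: total_weaken (total_row_loop (n := n) _ _) (leqnn _) _ => //.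
move=> st2 fr2 st2F.
apply: total_weaken (total_copy_loop (n := n) _) (leqnn _) _.
  by rewrite (proj1 fr2 0 isT).
by move=> st3 fr3 st3F j jn; rewrite st3F // st2F.
Qed.

End BellmanCommand.

(** * Commands for the connectives and the main program *)

Definition fill (ea eb ex : vexp) : cmd :=
  Seq (NSet 7 (NLit 0) (NGet 2 (nvar 3)))
    (for_ 5 0
      (Seq (VSet 6 (nvar 5) ea)
      (Seq (VSet 7 (nvar 5) eb)
      (Seq (VSet 8 (nvar 5) ex)
           (NSet 7 (NLit 0) (NAdd (nvar 7) (NGet 0 (NLit 1)))))))).

Fixpoint popped (d : nat) : nexp :=
  if d is d'.+1 then NSub (popped d') (nvar 0) else nvar 4.

(* With [em] = 0 iterations, the result of the connective is the vector [ex]. *)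
Definition op_cmd d em ea eb ex : cmd :=
  Seq (NSet 4 (NLit 0) (popped d)) (Seq (NSet 8 (NLit 0) em) (fill ea eb ex)).

(* The popped vectors stay readable above the new top: the argument [arg0] of a
   binary connective was pushed last, the last or only argument [arg1] lies
   below it. *)
Definition arg1 : vexp := VGet 4 (NAdd (nvar 4) (nvar 5)).
Definition arg0 : vexp := VGet 4 (NAdd (NAdd (nvar 4) (nvar 0)) (nvar 5)).
Definition alive_cell : vexp := VGet 5 (nvar 5).
Definition bound : nexp := NGet 2 (nvar 3).

(** The entry at position j implements the symbol j of [scode]; its last three expressions are the
    vectors a, b, x of [bellman] at the current state. *)
Definition op_table : seq cmd :=
  [:: op_cmd 0 (NLit 0) VZero VZero VOne;
      op_cmd 0 (NLit 0) VZero VZero (VGet 2 (nvar 7));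
      op_cmd 2 (NLit 0) VZero VZero (VMin arg0 arg1);
      op_cmd 1 (NLit 0) VZero VZero (VCompl arg1);
      op_cmd 1 (NLit 1) VZero VOne (VMin arg1 alive_cell);
      op_cmd 2 (nvar 0) (VMin arg1 alive_cell) arg0 (VMin arg1 alive_cell);
      (* truncated subtraction: q - (q - n) = min(q, n) *)
      op_cmd 2 (NSub bound (NSub bound (nvar 0)))
        (VMin arg1 alive_cell) arg0 (VMin arg1 alive_cell);
      op_cmd 1 (nvar 0) VZero arg1 VOne].

(** The test by [<=] acts as an equality test, as all smaller symbols have been excluded before. *)
Fixpoint dispatch k (cs : seq cmd) : cmd :=
  if cs is c :: cs' then
    If (BNLe (NGet 1 (nvar 3)) (NLit k)) c (dispatch k.+1 cs')
  else Skip.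

Definition push : cmd :=
  Seq (for_ 5 0 (VSet 4 (NAdd (nvar 4) (nvar 5)) (VGet 8 (nvar 5))))
      (NSet 4 (NLit 0) (NAdd (nvar 4) (nvar 0))).

Definition symbol_cmd : cmd :=
  Seq (NSet 3 (NLit 0) (NSub (nvar 3) (NLit 1)))
    (Seq (dispatch 0 op_table) (Seq iter_cmd push)).

Definition symbol_loop : cmd :=
  While (BNot (BNLe (nvar 3) (NLit 0))) symbol_cmd.

Definition alive_cmd : cmd :=
  Seq (NSet 8 (NLit 0) (nvar 0))
    (Seq (for_ 5 0 (Seq (VSet 7 (nvar 5) VOne) (VSet 8 (nvar 5) VOne)))
      (Seq iter_cmd (for_ 5 0 (VSet 5 (nvar 5) (VGet 8 (nvar 5)))))).

Definition model_checker : cmd :=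
  Seq alive_cmd
    (Seq (NSet 4 (NLit 0) (NLit 0))
      (Seq (NSet 3 (NLit 0) (NGet 0 (NLit 2)))
        (Seq symbol_loop (for_ 5 0 (VSet 3 (nvar 5) (VGet 4 (nvar 5))))))).

Lemma nth_allpairs (T1 T2 T3 : Type) (f : T1 -> T2 -> T3) s t x1 x2 x3 i j :
  i < size s -> j < size t ->
  nth x3 [seq f x y | x <- s, y <- t] (i * size t + j) =
  f (nth x1 s i) (nth x2 t j).
Proof.
elim: s i => //= x s IH [|i] i_lt jt; rewrite nth_cat size_map.
  by rewrite mul0n add0n jt (nth_map x2).
by rewrite ifN ?mulSn -?addnA ?addKn ?IH // -leqNgt leq_addr.
Qed.

(** * Memory invariants and correctness of the program *)

Section ModelChecker.
Variables (R : realType) (S AP : finType) (M : gpks R S AP) (Phi : sform AP).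
Local Notation min := Order.min.
Local Notation max := Order.max.
Local Notation n := #|S|.
Local Notation input := (input_store M Phi).
Implicit Types (st : store R) (m : nat -> R) (a b x : S -> R) (s t : S).
Implicit Types (stk : seq (S -> R)).

Lemma card_gt0_gpks : 0 < n.
Proof. by case: (gpks_inhabited M) => s; apply/card_gt0P; exists s. Qed.

Definition stored m o x := forall s, m (o + enum_rank s) = x s.

Lemma acc_max_enum_rank (F : nat -> R) :
  acc_max F n = \big[max/0%R]_(s : S) F (enum_rank s).
Proof.
have H r (y : R) : (0 <= y)%R ->
    foldl (fun z k => max z (F k)) y r = max y (\big[max/0%R]_(k <- r) F k).
  elim: r y => [|k r IH] y y0 /=; first by rewrite big_nil; apply/esym/max_idPl.
  by rewrite IH ?le_max ?y0 // big_cons maxA.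
rewrite /acc_max H //; move/max_idPr: (bigmax_ge_id (iota 0 n) 0%R xpredT F) => ->.
have -> : iota 0 n = [seq val (enum_rank s) | s <- enum S].
  apply: (@eq_from_nth _ 0) => [|i]; first by rewrite size_iota size_map cardE.
  rewrite size_iota => i_lt; rewrite nth_iota // add0n.
  set s := enum_val (Ordinal i_lt); rewrite (nth_map s) -?cardE //.
  have -> : nth s (enum S) i = s by rewrite {2}/s (enum_val_nth s).
  by rewrite enum_valK.
by rewrite big_map big_enum.
Qed.

Definition trans_table m :=
  forall s t, m (enum_rank s * n + enum_rank t) = gpks_P M s t.

Lemma input_trans_table : trans_table (vmem input 0).
Proof.
move=> s t; have := @nth_allpairs _ _ _ (gpks_P M) (enum S) (enum S) s t 0%R
  (enum_rank s) (enum_rank t).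
by rewrite -!cardE !nth_enum_rank; apply; exact: ltn_ord.
Qed.

Lemma input_label_table s p :
  vmem input 2 (enum_rank s * #|AP| + enum_rank p) = gpks_L M s p.
Proof.
have := @nth_allpairs _ _ _ (gpks_L M) (enum S) (enum AP) s p 0%R
  (enum_rank s) (enum_rank p).
by rewrite -!cardE !nth_enum_rank; apply; exact: ltn_ord.
Qed.

Lemma total_iter_cmd st k a b x :
  nmem st 0 0 = n -> nmem st 8 0 = k -> trans_table (vmem st 0) ->
  stored (vmem st 6) 0 a -> stored (vmem st 7) 0 b -> stored (vmem st 8) 0 x ->
  total iter_cmd st (10 + k * (200 * (n * n) + 13))
    (fun st' => stored (vmem st' 8) 0 (iter k (bellman M a b) x)).
Proof.
move=> stn stk stP sta stb stx.
apply: (total_for (N := k) (T := 200 * (n * n)) (Inv := fun i st' =>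
  stored (vmem st' 8) 0 (iter i (bellman M a b) x))) => //.
move=> i st' ik _ fr IH.
apply: total_weaken (total_bellman_cmd (n := n) _ card_gt0_gpks) (leqnn _) _.
  by rewrite (proj1 fr 0 isT).
move=> st2 fr2 H s; rewrite add0n H ?ltn_ord // acc_max_enum_rank.
rewrite (proj2 fr 6 isT) (proj2 fr 7 isT) (proj2 fr 0 isT).
rewrite iterS -[in LHS](add0n (enum_rank s)) sta stb /bellman.
congr (max _ (min _ _)); apply: eq_bigr => t _.
by rewrite add0n stP -(IH t).
Qed.

Definition ready st :=
  [/\ forall i, i < 3 -> nmem st i = nmem input i,
      vmem st 0 = vmem input 0, vmem st 2 = vmem input 2 &
      stored (vmem st 5) 0 (alive M)].

Lemma ready_framed ns vs st st' : framed ns vs st st' ->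
  all (fun i => i \notin ns) (iota 0 3) ->
  all (fun i => i \notin vs) [:: 0; 2; 5] -> ready st -> ready st'.
Proof.
move=> [frn frv] /allP hn /allP hv [st_n stP stL stD].
split; rewrite ?frv ?hv //.
by move=> i i3; rewrite frn ?st_n // hn // mem_iota.
Qed.

Lemma ready_nset st i v k : 3 <= i -> ready st ->
  ready (Store (upd (nmem st) i v k) (vmem st)).
Proof.
move=> i3 [st_n stP stL stD]; split=> //= j j3.
by rewrite /upd ltn_eqF ?st_n //; exact: leq_trans i3.
Qed.

(** The head of the list is the top of the stack; the deepest vector starts at cell 0. *)
Fixpoint stacked m stk :=
  if stk is x :: stk' then stored m (size stk' * n) x /\ stacked m stk'
  else True.

Lemma stacked_eq m m' stk : (forall j, j < size stk * n -> m' j = m j) ->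
  stacked m stk -> stacked m' stk.
Proof.
elim: stk => //= x stk IH mm [xm stm]; split.
  by move=> s; rewrite mm ?xm // mulSn addnC ltn_add2r ltn_ord.
by apply: IH stm => j jlt; apply: mm; rewrite mulSn ltn_addl.
Qed.

(** Invariant between two symbols: as the code is read from the right, the first [i] symbols are
    still to come. *)
Definition scanned st stk i :=
  [/\ ready st, nmem st 3 0 = i, nmem st 4 0 = size stk * n &
      stacked (vmem st 4) stk].

(** Scalar 7 starts at the parameter [p] and grows by |AP| per state, so for an atomic proposition
    it points to its label in the row of that state. The evaluation hypothesis ranges over all
    framed stores because the three expressions are evaluated at different moments. *)
Lemma total_fill st p ea eb ex a b x :
  vcost ea <= 20 -> vcost eb <= 20 -> vcost ex <= 20 ->
  nmem st 0 = nmem input 0 -> nmem st 2 (nmem st 3 0) = p ->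
  (forall st' s, framed [:: 5; 7] [:: 6; 7; 8] st st' ->
    nmem st' 5 0 = enum_rank s -> nmem st' 7 0 = enum_rank s * #|AP| + p ->
    [/\ veval st' ea = a s, veval st' eb = b s & veval st' ex = x s]) ->
  total (fill ea eb ex) st (15 + n * 96)
    (fun st' => [/\ stored (vmem st' 6) 0 a, stored (vmem st' 7) 0 b &
      stored (vmem st' 8) 0 x]).
Proof.
move=> ca cb cx st_n stp Heval.
apply: (total_seq (T1 := 5) (T2 := 10 + n * 96)); last lia.
apply: total_nset => //=; rewrite stp; set st0 := Store _ _.
have fr0 : framed [:: 5; 7] [:: 6; 7; 8] st st0.
  split=> //= i; rewrite !inE !negb_or => /andP[_ /negbTE i7].
  by rewrite /upd i7.
apply: (total_for (N := n) (T := 83) (Inv := fun k st' =>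
  nmem st' 7 0 = k * #|AP| + p /\ forall s, enum_rank s < k ->
  [/\ vmem st' 6 (enum_rank s) = a s, vmem st' 7 (enum_rank s) = b s &
      vmem st' 8 (enum_rank s) = x s])) => //.
- by rewrite -[LHS]/(nmem st 0 0) st_n.
- move=> k st1 kn ik fr [st1q IH].
  have {}fr : framed [:: 5; 7] [:: 6; 7; 8] st st1.
    by apply: framed_trans fr0 _; apply: framed_sub fr; apply/allP.
  set s := enum_val (Ordinal kn); have sk : k = enum_rank s by rewrite enum_valK.
  have st1s : nmem st1 5 0 = enum_rank s by rewrite ik.
  have step v st2 i y : i \in [:: 6; 7; 8] ->
      framed [:: 5; 7] [:: 6; 7; 8] st st2 ->
      framed [:: 5; 7] [:: 6; 7; 8] st (Store (nmem st2) (upd (vmem st2) i v y)).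
    move=> hi [fn fv]; split=> //= j hj; rewrite /upd.
    by case: eqP hj => [->|_ /fv//]; rewrite hi.
  rewrite sk in st1q.
  apply: (total_seq (T1 := 23) (T2 := 60)) => //.
  apply: total_vset; first by rewrite /=; lia.
  have [-> _ _] := Heval _ _ fr st1s st1q; set st2 := Store _ _.
  have fr2 : framed [:: 5; 7] [:: 6; 7; 8] st st2 by exact: step.
  apply: (total_seq (T1 := 23) (T2 := 37)) => //.
  apply: total_vset; first by rewrite /=; lia.
  have [_ -> _] := Heval st2 _ fr2 st1s st1q; set st3 := Store _ _.
  have fr3 : framed [:: 5; 7] [:: 6; 7; 8] st st3 by exact: step.
  apply: (total_seq (T1 := 23) (T2 := 9)) => //.
  apply: total_vset; first by rewrite /=; lia.
  have [_ _ ->] := Heval st3 _ fr3 st1s st1q.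
  apply: total_nset => //=; split.
    by rewrite /upd /= st1q (proj1 fr 0 isT) st_n /= sk mulSnr addnAC.
  move=> t; rewrite ltnS leq_eqVlt /upd /= st1s sk; case: eqP => [|_ /=].
    by move=> /val_inj/enum_rank_inj -> _.
  by rewrite -sk; exact: IH.
- by move=> st' _ [_ H]; split=> s; rewrite add0n; case: (H s (ltn_ord _)).
Qed.

(** The list [stk0] consists of the popped arguments; lowering the stack pointer leaves their cells
    intact. *)
Lemma total_op_cmd st d em ea eb ex k stk0 stk a b x i p :
  d <= 2 -> ncost em <= 10 ->
  vcost ea <= 20 -> vcost eb <= 20 -> vcost ex <= 20 ->
  scanned st (stk0 ++ stk) i -> size stk0 = d -> nmem input 2 i = p ->
  (forall st', ready st' -> nmem st' 3 0 = i -> neval st' em = k) ->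
  (forall st' s, ready st' -> nmem st' 4 0 = size stk * n ->
    stacked (vmem st' 4) (stk0 ++ stk) ->
    nmem st' 5 0 = enum_rank s -> nmem st' 7 0 = enum_rank s * #|AP| + p ->
    [/\ veval st' ea = a s, veval st' eb = b s & veval st' ex = x s]) ->
  total (op_cmd d em ea eb ex) st (40 + n * 96)
    (fun st' => [/\ scanned st' stk i, nmem st' 8 0 = k,
      stored (vmem st' 6) 0 a, stored (vmem st' 7) 0 b &
      stored (vmem st' 8) 0 x]).
Proof.
move=> d2 cm ca cb cx [st_r st3 st4 st_s] sd ip Hm Heval.
have st0 : nmem st 0 0 = n by case: st_r => -> .
have pop : neval st (popped d) = size stk * n.
  rewrite size_cat sd mulnDl in st4.
  have -> : neval st (popped d) = nmem st 4 0 - d * n.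
    by elim: (d) => /= [|e ->]; rewrite ?subn0 // st0 mulSn addnC subnDA.
  by rewrite st4 addKn.
have cpop : ncost (popped d) <= 8 by case: (d) d2 => [|[|[|]]].
apply: (total_seq (T1 := 10) (T2 := 30 + n * 96)); last lia.
apply: total_nset; first by rewrite /=; lia.
rewrite pop /=; set st1 := Store _ _.
have st1_r : ready st1 by exact: ready_nset.
have st1m : neval st1 em = k by exact: Hm.
apply: (total_seq (T1 := 12) (T2 := 15 + n * 96)); last by rewrite addnA leq_add2r.
apply: total_nset; first by rewrite /=; lia.
rewrite st1m /=; set st2 := Store _ _.
have st2_r : ready st2 by exact: (@ready_nset st1 8 0 k).
apply: total_weaken (total_fill (p := p) (a := a) (b := b) (x := x)
  ca cb cx _ _ _) (leqnn _) _.
- by case: st_r => H _ _ _; exact: H.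
- by case: st_r => H _ _ _; rewrite -[LHS]/(nmem st 2 (nmem st 3 0)) st3 H.
- move=> st' s fr; apply: Heval.
  + exact: ready_framed fr _ _ st2_r.
  + by rewrite (proj1 fr 4 isT).
  + by rewrite (proj2 fr 4 isT).
move=> st' fr [Ha Hb Hx]; split=> //; last by rewrite (proj1 fr 8 isT).
split; first exact: ready_framed fr _ _ st2_r.
- by rewrite (proj1 fr 3 isT).
- by rewrite (proj1 fr 4 isT).
rewrite (proj2 fr 4 isT) /=; move: st_s; move: {sd Heval st4} stk0.
by elim=> //= y stk0 IH [_]; exact: IH.
Qed.

Lemma total_dispatch j0 j cs st T Q : nmem st 1 (nmem st 3 0) = j0 + j ->
  j < size cs -> total (nth Skip cs j) st T Q ->
  total (dispatch j0 cs) st (T + 6 * j.+1) Q.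
Proof.
elim: cs j0 j => // c' cs IH j0 [|j] stj /= jcs H.
  by apply: (total_if (T := T)); [rewrite /= stj addn0 leqnn|rewrite /=; lia].
apply: (total_if (T := T + 6 * j.+1)); last by rewrite /=; lia.
rewrite /= stj ifN; last by rewrite -ltnNge; lia.
by apply: IH => //; rewrite stj addnS addSn.
Qed.

Lemma total_push st stk x i : scanned st stk i -> stored (vmem st 8) 0 x ->
  total push st (20 + n * 22) (fun st' => scanned st' (x :: stk) i).
Proof.
move=> [st_r st3 st4 st_s] stx.
have st0 : nmem st 0 0 = n by case: st_r => -> .
apply: (total_seq (T1 := 10 + n * 22) (T2 := 7)); last lia.
apply: (total_for (N := n) (T := 9) (Inv := fun k st' =>
  (forall s, enum_rank s < k -> vmem st' 4 (size stk * n + enum_rank s) = x s) /\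
  (forall j, j < size stk * n -> vmem st' 4 j = vmem st 4 j))) => //.
- move=> k st' kn ik fr [IH1 IH2]; apply: total_vset => //=.
  rewrite ik (proj1 fr 4 isT) (proj2 fr 8 isT) st4; split.
    move=> s; rewrite ltnS leq_eqVlt /upd /= eqn_add2l.
    by case: eqP => [<- _|_ /=]; [rewrite -(stx s)|exact: IH1].
  move=> j jlt; rewrite /upd /= ltn_eqF ?IH2 //.
  exact: ltn_addr.
move=> st' fr [H1 H2]; apply: total_nset => //=.
split=> //=.
- by apply: ready_nset => //; exact: ready_framed fr _ _ st_r.
- by rewrite -[LHS]/(nmem st' 3 0) (proj1 fr 3 isT).
- by rewrite /upd /= (proj1 fr 4 isT) (proj1 fr 0 isT) st4 st0 mulSn addnC.
by split; [move=> s; exact: H1|exact: stacked_eq H2 st_s].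
Qed.

Lemma total_symbol_cmd st j d em ea eb ex k stk0 stk a b x i p :
  nth Skip op_table j = op_cmd d em ea eb ex -> j < 8 ->
  d <= 2 -> ncost em <= 10 ->
  vcost ea <= 20 -> vcost eb <= 20 -> vcost ex <= 20 ->
  scanned st (stk0 ++ stk) i.+1 -> size stk0 = d ->
  nmem input 1 i = j -> nmem input 2 i = p -> k <= n ->
  (forall st', ready st' -> nmem st' 3 0 = i -> neval st' em = k) ->
  (forall st' s, ready st' -> nmem st' 4 0 = size stk * n ->
    stacked (vmem st' 4) (stk0 ++ stk) ->
    nmem st' 5 0 = enum_rank s -> nmem st' 7 0 = enum_rank s * #|AP| + p ->
    [/\ veval st' ea = a s, veval st' eb = b s & veval st' ex = x s]) ->
  total symbol_cmd st (500 * (n * (n * n)))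
    (fun st' => scanned st' (iter k (bellman M a b) x :: stk) i).
Proof.
move=> opj j8 d2 cm ca cb cx [st_r st3 st4 st_s] sd ij ip kn Hm Heval.
have n0 := card_gt0_gpks.
(* The summands are the decrement, eight tests of the dispatcher, the operation, at most |S| Bellman
   iterations and the push. *)
have arith : 6 + (48 + (40 + n * 96) + (10 + n * (200 * (n * n) + 13) +
    (20 + n * 22))) <= 500 * (n * (n * n)) by nia.
rewrite /symbol_cmd; set cases := dispatch _ _.
apply: total_seq arith; apply: total_nset => //=.
rewrite st3 subn1 /=; set st1 := Store _ _.
have st1_s : scanned st1 (stk0 ++ stk) i by split=> //; exact: ready_nset.
have st1j : nmem st1 1 (nmem st1 3 0) = 0 + j.
  by case: st1_s => [[H _ _ _] -> _ _]; rewrite H.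
apply: total_seq (leqnn _); apply: total_weaken.
- rewrite /cases; apply: (total_dispatch st1j) => //; rewrite opj.
  exact: (total_op_cmd d2 cm ca cb cx st1_s sd ip Hm Heval).
- by rewrite addnC leq_add2r -[48]/(6 * 8) leq_mul2l.
move=> st2 _ [st2_s st2k st2a st2b st2x].
apply: total_seq (leqnn _); apply: total_weaken.
- have [[H HP _ _] _ _ _] := st2_s.
  apply: (total_iter_cmd _ st2k _ st2a st2b st2x); first by rewrite H.
  by rewrite HP; exact: input_trans_table.
- by rewrite leq_add2l leq_mul2r kn orbT.
move=> st3' fr3 st3x; apply: total_push => //.
case: st2_s => st2_r st2_3 st2_4 st2_s; split.
- exact: ready_framed fr3 _ _ st2_r.
- by rewrite (proj1 fr3 3 isT).
- by rewrite (proj1 fr3 4 isT).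
- by rewrite (proj2 fr3 4 isT).
Qed.

Lemma input_symbol i c r : drop i (scode Phi) = c :: r ->
  nmem input 1 i = c.1 /\ nmem input 2 i = c.2.
Proof.
move=> Hd; split; rewrite /= -[i in LHS]addn0 -nth_drop -map_drop Hd //.
Qed.

(** In continuation style, the rest of the loop enters as a premise with its own budget [T]. The 506
    provides 500 for the symbol and at least 6 for the loop test. *)
Lemma total_loop_step st c r d em ea eb ex k stk0 stk a b x y i T Q :
  drop i (scode Phi) = c :: r ->
  nth Skip op_table c.1 = op_cmd d em ea eb ex ->
  [&& c.1 < 8, d <= 2, ncost em <= 10, vcost ea <= 20, vcost eb <= 20 &
      vcost ex <= 20] ->
  scanned st (stk0 ++ stk) i.+1 -> size stk0 = d -> k <= n ->
  (forall st', ready st' -> nmem st' 3 0 = i -> neval st' em = k) ->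
  (forall st' s, ready st' -> nmem st' 4 0 = size stk * n ->
    stacked (vmem st' 4) (stk0 ++ stk) ->
    nmem st' 5 0 = enum_rank s -> nmem st' 7 0 = enum_rank s * #|AP| + c.2 ->
    [/\ veval st' ea = a s, veval st' eb = b s & veval st' ex = x s]) ->
  iter k (bellman M a b) x = y ->
  (forall st', scanned st' (y :: stk) i -> total symbol_loop st' T Q) ->
  total symbol_loop st (506 * (n * (n * n)) + T) Q.
Proof.
move=> /input_symbol[i1 i2] opj /and5P[j8 d2 cm ca /andP[cb cx]] st_s sd kn.
move=> Hm Heval <- HQ; apply: (total_while_true (T1 := 500 * (n * (n * n))) (T2 := T)).
- by case: st_s => _ /= -> _ _.
- apply: total_weaken (total_symbol_cmd opj j8 d2 cm ca cb cx st_s sd i1 i2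
    kn Hm Heval) (leqnn _) _.
  by move=> st' _; exact: HQ.
- have arith N : 0 < N -> (5 + 500 * N + T).+1 <= 506 * N + T by clear; lia.
  by apply: arith; rewrite !muln_gt0 card_gt0_gpks.
Qed.

(** * Reading arguments and scanning the code from right to left *)

Lemma veval_top st g stk s : nmem st 4 0 = size stk * n ->
  nmem st 5 0 = enum_rank s -> stacked (vmem st 4) (g :: stk) ->
  veval st arg1 = g s.
Proof. by move=> /= -> -> [H _]; exact: H. Qed.

Lemma veval_second st g h stk s : ready st -> nmem st 4 0 = size stk * n ->
  nmem st 5 0 = enum_rank s -> stacked (vmem st 4) [:: g, h & stk] ->
  veval st arg0 = g s /\ veval st arg1 = h s.
Proof.
move=> [H _ _ _] st4 st5 [sg sh]; split; last exact: veval_top sh.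
rewrite /= st4 st5 H //=; have := sg s.
by rewrite [size _]/= mulSnr.
Qed.

Lemma veval_alive st s : ready st -> nmem st 5 0 = enum_rank s ->
  veval st alive_cell = alive M s.
Proof. by move=> [_ _ _ H] /= ->; exact: H. Qed.

(** Consuming the code of [f] pushes its value vector. The continuation form is needed because one
    loop runs over the whole code and does not stop between subformulae. *)
Definition scans (f : sform AP) := forall i st stk T Q r,
  scanned st stk (i + slen f) -> drop i (scode Phi) = scode f ++ r ->
  (forall st', scanned st' (sem M f :: stk) i -> total symbol_loop st' T Q) ->
  total symbol_loop st (slen f * (506 * (n * (n * n))) + T) Q.

Lemma scans_arg g : scans g -> forall i c st stk T Q r,
  scanned st stk (i.+1 + slen g) -> drop i (scode Phi) = c :: scode g ++ r ->
  (forall st', scanned st' (sem M g :: stk) i.+1 ->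
    total symbol_loop st' T Q) ->
  total symbol_loop st (slen g * (506 * (n * (n * n))) + T) Q.
Proof.
move=> Sg i c st stk T Q r st_s Hd; apply: (Sg _ _ _ _ _ r st_s).
by rewrite -add1n -drop_drop Hd /= drop0.
Qed.

(** The right argument is scanned first, hence the left one ends on top of the stack. *)
Lemma scans_cat g h : scans g -> scans h -> forall i c st stk T Q r,
  scanned st stk (i.+1 + (slen g + slen h)) ->
  drop i (scode Phi) = c :: (scode g ++ scode h) ++ r ->
  (forall st', scanned st' [:: sem M g, sem M h & stk] i.+1 ->
    total symbol_loop st' T Q) ->
  total symbol_loop st ((slen g + slen h) * (506 * (n * (n * n))) + T) Q.
Proof.
move=> Sg Sh i c st stk T Q r st_s Hd HQ.
have Hd1 : drop i.+1 (scode Phi) = scode g ++ (scode h ++ r).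
  by rewrite -add1n -drop_drop Hd /= drop0 catA.
have Hd2 : drop (i.+1 + slen g) (scode Phi) = scode h ++ r.
  by rewrite addnC -drop_drop Hd1 -size_scode drop_size_cat.
rewrite mulnDl (addnC (slen g * _)) -addnA; apply: (Sh _ _ _ _ _ _ _ Hd2).
  by rewrite -addnA; exact: st_s.
by move=> st' st'_s; apply: (Sg _ _ _ _ _ _ st'_s Hd1).
Qed.

(** Each case supplies the vectors and the iteration count of its table entry. For propositional
    connectives the count is 0 and [x] is already the value; for temporal ones the Bellman
    characterisation of Po identifies the iterate. *)
Lemma scans_all f : scans f.
Proof.
apply: (sform_pform_ind (P := scans) (P0 := fun phi => scans (SPo phi))) f => //.
- move=> i st stk T Q r st_s Hd HQ; rewrite mul1n.
  rewrite addn1 in st_s.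
  apply: (total_loop_step (k := 0) (stk0 := [::]) (a := fun=> 0%R) (b := fun=> 0%R)
    (x := fun=> 1%R) Hd _ _ st_s) => //.
- move=> p i st stk T Q r st_s Hd HQ; rewrite mul1n.
  rewrite addn1 in st_s.
  apply: (total_loop_step (k := 0) (stk0 := [::]) (a := fun=> 0%R) (b := fun=> 0%R)
    (x := sem M (SAtom p)) Hd _ _ st_s) => //.
  move=> st' s [_ _ stL _] _ _ _ stq; split=> //.
  by rewrite -[LHS]/(vmem st' 2 (nmem st' 7 0)) stq stL input_label_table.
- move=> g Sg h Sh i st stk T Q r st_s Hd HQ.
  rewrite [slen _]/= mulnDl mul1n -addnA.
  rewrite [slen _]/= addnA addn1 -addSn in st_s.
  apply: (scans_cat Sg Sh st_s Hd) => st' {}st_s.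
  apply: (total_loop_step (k := 0) (stk0 := [:: sem M g; sem M h])
    (a := fun=> 0%R) (b := fun=> 0%R) (x := sem M (SAnd g h)) Hd _ _ st_s) => //.
  move=> st2 s st2_r st24 st2_s st25 _; split=> //.
  by have [Eg Eh] := veval_second st2_r st24 st25 st2_s; rewrite /= -Eg -Eh.
- move=> g Sg i st stk T Q r st_s Hd HQ.
  rewrite [slen _]/= mulnDl mul1n -addnA.
  rewrite [slen _]/= addnA addn1 -addSn in st_s.
  apply: (scans_arg Sg st_s Hd) => st' {}st_s.
  apply: (total_loop_step (k := 0) (stk0 := [:: sem M g])
    (a := fun=> 0%R) (b := fun=> 0%R) (x := sem M (SNot g)) Hd _ _ st_s) => //.
  move=> st2 s st2_r st24 st2_s st25 _; split=> //.
  by rewrite /= -(veval_top st24 st25 st2_s).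
- move=> g Sg i st stk T Q r st_s Hd HQ.
  rewrite [slen _]/= mulnDl mul1n -addnA.
  rewrite [slen _]/= addnA addn1 -addSn in st_s.
  apply: (scans_arg Sg st_s Hd) => st' {}st_s.
  apply: (total_loop_step (k := 1) (stk0 := [:: sem M g])
    (a := fun=> 0%R) (b := fun=> 1%R)
    (x := fun s => min (sem M g s) (alive M s)) (y := sem M (SPo (PNext g)))
    Hd _ _ st_s) => //.
  (* A single iteration stays within the limit |S| because S is nonempty. *)
  + exact: card_gt0_gpks.
  + move=> st2 s st2_r st24 st2_s st25 _; split=> //.
    by rewrite -(veval_top st24 st25 st2_s) -(veval_alive st2_r st25).
  + by apply: boolp.funext => s; rewrite sem_next //; exact: unit_valued_sem.
- move=> g Sg h Sh i st stk T Q r st_s Hd HQ.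
  rewrite [slen _]/= mulnDl mul1n -addnA.
  rewrite [slen _]/= addnA addn1 -addSn in st_s.
  apply: (scans_cat Sg Sh st_s Hd) => st' {}st_s.
  apply: (total_loop_step (k := n) (stk0 := [:: sem M g; sem M h])
    (a := fun s => min (sem M h s) (alive M s)) (b := sem M g)
    (x := fun s => min (sem M h s) (alive M s)) (y := sem M (SPo (PUntil g h)))
    Hd _ _ st_s) => //.
  + by move=> st2 [H _ _ _] _; rewrite /= H.
  + move=> st2 s st2_r st24 st2_s st25 _.
    have [<- Eh] := veval_second st2_r st24 st25 st2_s.
    by rewrite -Eh -(veval_alive st2_r st25).
  + by apply: boolp.funext => s; rewrite sem_until //; exact: unit_valued_sem.
- move=> q g Sg h Sh i st stk T Q r st_s Hd HQ.
  rewrite [slen _]/= mulnDl mul1n -addnA.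
  rewrite [slen _]/= addnA addn1 -addSn in st_s.
  apply: (scans_cat Sg Sh st_s Hd) => st' {}st_s.
  apply: (total_loop_step (k := minn q n) (stk0 := [:: sem M g; sem M h])
    (a := fun s => min (sem M h s) (alive M s)) (b := sem M g)
    (x := fun s => min (sem M h s) (alive M s)) (y := sem M (SPo (PBUntil q g h)))
    Hd _ _ st_s) => //.
  + exact: geq_minr.
  + move=> st2 [H _ _ _] st23; have [_ Ep] := input_symbol Hd.
    rewrite -[LHS]/(nmem st2 2 (nmem st2 3 0) - (nmem st2 2 (nmem st2 3 0) - nmem st2 0 0)).
    by rewrite st23 !H // Ep minnE.
  + move=> st2 s st2_r st24 st2_s st25 _.
    have [<- Eh] := veval_second st2_r st24 st25 st2_s.
    by rewrite -Eh -(veval_alive st2_r st25).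
  + by apply: boolp.funext => s; rewrite sem_buntil //; exact: unit_valued_sem.
- move=> g Sg i st stk T Q r st_s Hd HQ.
  rewrite [slen _]/= mulnDl mul1n -addnA.
  rewrite [slen _]/= addnA addn1 -addSn in st_s.
  apply: (scans_arg Sg st_s Hd) => st' {}st_s.
  apply: (total_loop_step (k := n) (stk0 := [:: sem M g])
    (a := fun=> 0%R) (b := sem M g) (x := fun=> 1%R)
    (y := sem M (SPo (PAlways g))) Hd _ _ st_s) => //.
  + by move=> st2 [H _ _ _] _; rewrite /= H.
  + move=> st2 s st2_r st24 st2_s st25 _; split=> //.
    exact: veval_top st24 st25 st2_s.
  + by apply: boolp.funext => s; rewrite sem_always //; exact: unit_valued_sem.
Qed.

(** * The preliminary computation of D and the complete run *)

Lemma total_alive_cmd : total alive_cmd input (500 * (n * (n * n))) ready.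
Proof.
have n0 := card_gt0_gpks.
have arith : 4 + (10 + n * 21 + (10 + n * (200 * (n * n) + 13) + (10 + n * 19)))
  <= 500 * (n * (n * n)) by nia.
apply: total_seq arith; apply: total_nset => //=; set st0 := Store _ _.
apply: total_seq (leqnn _).
apply: (total_for (N := n) (T := 8) (Inv := fun k st => forall j, j < k ->
  vmem st 7 j = 1%R /\ vmem st 8 j = 1%R)) => //.
  move=> k st kn ik fr IH; apply: (total_seq (T1 := 4) (T2 := 4)) => //.
  apply: total_vset => //; apply: total_vset => //= j.
  by rewrite /upd /= ik ltnS leq_eqVlt; case: eqP => //= _; exact: IH.
move=> st1 fr1 H1; apply: total_seq (leqnn _); apply: total_weaken.
- apply: (total_iter_cmd (k := n) (a := fun=> 0%R) (b := fun=> 1%R)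
    (x := fun=> 1%R)).
  + by rewrite (proj1 fr1 0 isT).
  + by rewrite (proj1 fr1 8 isT).
  + by rewrite (proj2 fr1 0 isT); exact: input_trans_table.
  (* Array 6 has not been written yet, so its default cells 0 provide the vector a. *)
  + by move=> s; rewrite (proj2 fr1 6 isT) /= nth_nil.
  + by move=> s; case: (H1 _ (ltn_ord (enum_rank s))).
  + by move=> s; case: (H1 _ (ltn_ord (enum_rank s))).
- by [].
move=> st2 fr2 H2.
apply: (total_for (N := n) (T := 6) (Inv := fun k st => forall s : S,
  enum_rank s < k -> vmem st 5 (enum_rank s) = alive M s)) => //.
- by rewrite (proj1 fr2 0 isT) (proj1 fr1 0 isT).
- move=> k st kn ik fr IH; apply: total_vset => //= s.
  rewrite /upd /= ik ltnS leq_eqVlt; case: eqP => [<- _|_ /=]; last exact: IH.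
  by rewrite (proj2 fr 8 isT); exact: H2.
move=> st3 fr3 H3; split.
- move=> i i3.
  have hi c : all (fun j => 2 < j) (nmods c) -> i \notin nmods c.
    by move=> /allP h; apply/negP => /h; rewrite ltnNge -ltnS i3.
  rewrite (proj1 fr3) ?hi // (proj1 fr2) ?hi // (proj1 fr1) ?hi //.
  by rewrite /st0 /= /upd ltn_eqF //; exact: leq_trans i3 _.
- by rewrite (proj2 fr3 0 isT) (proj2 fr2 0 isT) (proj2 fr1 0 isT).
- by rewrite (proj2 fr3 2 isT) (proj2 fr2 2 isT) (proj2 fr1 2 isT).
- by move=> s; exact: H3.
Qed.

Lemma total_model_checker :
  total model_checker input (2000 * (n * (n * n) * slen Phi))
    (fun st => forall s, output st s = sem M Phi s).
Proof.
have n0 := card_gt0_gpks.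
have len0 : 0 < slen Phi by rewrite -size_scode; case: (Phi) => // -[].
have arith : 500 * (n * (n * n)) + (3 + (4 + (slen Phi * (506 * (n * (n * n))) + 7
    + (10 + n * 20)))) <= 2000 * (n * (n * n) * slen Phi).
  have : n * (n * n) <= n * (n * n) * slen Phi by rewrite leq_pmulr.
  have : n <= n * (n * n) by rewrite leq_pmulr // muln_gt0 n0.
  by move: (n * (n * n)) => N nN; rewrite (mulnC (slen Phi)) -mulnA; lia.
apply: total_seq arith; apply: total_weaken total_alive_cmd (leqnn _) _ => st1 _ st1_r.
apply: total_seq (leqnn _); apply: total_nset => //=; set st2 := Store _ _.
have st2_r : ready st2 by exact: ready_nset.
apply: total_seq (leqnn _); apply: total_nset => //=; set st3 := Store _ _.
have st3_r : ready st3 by exact: (@ready_nset st2).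
apply: total_seq (leqnn _).
have st3_s : scanned st3 [::] (0 + slen Phi).
  split=> //; rewrite -[LHS]/(nmem st1 0 2) add0n -size_scode.
  by case: st1_r => H _ _ _; rewrite H.
apply: (scans_all (f := Phi) (r := [::]) st3_s); first by rewrite drop0 cats0.
move=> st4 [st4_r st43 _ [st4s _]].
apply: total_while_false => //; first by rewrite /= st43.
apply: (total_for (N := n) (T := 6) (Inv := fun k st => forall s : S,
  enum_rank s < k -> vmem st 3 (enum_rank s) = sem M Phi s)) => //.
- by case: st4_r => H _ _ _; rewrite H.
- move=> k st kn ik fr IH; apply: total_vset => //= s.
  rewrite /upd /= ik ltnS leq_eqVlt; case: eqP => [<- _|_ /=]; last exact: IH.
  by rewrite (proj2 fr 4 isT) -(st4s s).
- by rewrite leq_add2l leq_mul2l orbT.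
by move=> st5 _ H s; exact: H.
Qed.

End ModelChecker.

Local Open Scope ring_scope.

(* One program, with one bound C * (size(M) * p(|S|) * |Phi|) on its running
   time, computes the values ||Phi||(s), s in S, for all M and Phi. *)
Theorem theorem3 (R : realType) :
  exists (prog : cmd) (C : nat) (p : {poly nat}),
  forall (S AP : finType) (M : gpks R S AP) (Phi : sform AP),
  exists (t : nat) (st : store R),
    exec prog (input_store M Phi) t st
    /\ (t <= C * (gpks_size M * p.[#|S|]%R * slen Phi))%N
    /\ forall s : S, output st s = sem M Phi s.
Proof.
(* The run takes at most 2000 |S|^3 |Phi| steps; one factor |S| is bounded by the size of M, which
   leaves the polynomial X^2. *)
exists model_checker, 2000%N, 'X^2 => S AP M Phi.
have [t [st [Hex Ht Hout]]] := total_model_checker M Phi.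
exists t, st; split=> //; split=> //; apply: (leq_trans Ht).
rewrite hornerXn leq_mul2l leq_mul2r; apply/orP; right; apply/orP; right.
by apply: leq_mul; rewrite ?leq_addr.
Qed.
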